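(* Let $(X_\alpha)$ be a family of real-valued random variables, with integrated quantile functions $\mathsf K_{X_\alpha}$. Then the following statements are equivalent: (i) The family of distributions $\{\operatorname{Law}(X_\alpha)\}$ is tight. (ii) For every $u,v\in(0,1)$, $\sup_\alpha|\mathsf K_{X_\alpha}(u)-\mathsf K_{X_\alpha}(v)|<\infty$. (iii) The family of functions $\{\mathsf K_{X_\alpha}\}$ is pointwise bounded on $(0,1)$. (iv) The family of functions $\{\mathsf K_{X_\alpha}\}$ is equicontinuous on every $[a,b]\subset(0,1)$.
   Context: For a random variable $X$ with distribution function $F_X(x)=\mathsf P(X\le x)$, the integrated distribution function is $\mathsf J_X(x)=\int_0^xF_X(t)\,dt$, $x\in\mathbb R$ (with $\int_a^b:=-\int_b^a$ if $b<a$), and the integrated quantile function is its Fenchel transform $\mathsf K_X(u)=\sup_{x\in\mathbb R}\{xu-\mathsf J_X(x)\}$, $u\in\mathbb R$; it is finite on $(0,1)$. The random variables $X_\alpha$ may be defined on different probability spaces. *)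

(* Defs.v *)
From HB Require Import structures.
From mathcomp Require Import all_boot all_order all_algebra.
From mathcomp Require Import all_classical all_reals all_analysis measurable_realfun.
From mathcomp Require Import lra.
Set Implicit Arguments.
Unset Strict Implicit.
Unset Printing Implicit Defensive.
Import Order.TTheory GRing.Theory Num.Theory.
Import numFieldNormedType.Exports.

Local Open Scope classical_set_scope.
Local Open Scope ring_scope.

(* The integral from a to b, with the sign convention for b < a. *)
Definition oriented_integral (R : realType) (a b : R) (f : R -> R) : R :=
  if a <= b then \int[lebesgue_measure]_(t in `[a, b]) f t
  else - \int[lebesgue_measure]_(t in `[b, a]) f t.

Section integrated_functions.
Context d (T : measurableType d) (R : realType) (P : probability T R).
Variable X : {RV P >-> R}.

Definition integrated_cdf (x : R) : R :=
  oriented_integral 0 x (fun t => fine (cdf X t)).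

(* The supremum is +oo for u outside [0, 1]. *)
Definition integrated_quantile (u : R) : \bar R :=
  ereal_sup (range (fun x : R => (x * u - integrated_cdf x)%:E)).

End integrated_functions.

Definition tight (R : realType) (I : Type)
    (mu : I -> probability R R) : Prop :=
  forall e : R, 0 < e ->
    exists2 A : set R, compact A & forall i, (mu i (~` A) <= e%:E)%E.

(* Equicontinuity on D is equicontinuity of the restrictions to D, for the
   topology induced on D. *)
Definition equicontinuous_on (R : realType) (I : Type) (D : set R)
    (f : I -> R -> R) : Prop :=
  @equicontinuous (subspace D) R I [set: I] f.

(* Hence [fine (integrated_quantile X u)] is the integrated quantile function
   itself for u in (0, 1). *)
Lemma integrated_quantile_fin_num d (T : measurableType d) (R : realType)
    (P : probability T R) (X : {RV P >-> R}) (u : R) :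
  0 < u < 1 -> integrated_quantile X u \is a fin_num.
Proof.
move=> /andP[u0 u1].
have [F FX] : exists F, F = (fun t => fine (cdf X t)) by exists (fun t => fine (cdf X t)).
have FE t : (F t)%:E = cdf X t by rewrite FX fineK// fin_num_measure.
have F0 t : 0 <= F t by rewrite -lee_fin FE cdf_ge0.
have F1 t : F t <= 1 by rewrite -lee_fin FE cdf_le1.
have Fnd s t : s <= t -> F s <= F t.
  by move=> st; rewrite -lee_fin !FE; exact: cdf_nondecreasing.
have mF : measurable_fun [set: R] F.
  by apply/measurable_EFinP; rewrite (_ : EFin \o F = cdf X) ?funeqE//; exact: cdf_measurable.
have iF (a b : R) : lebesgue_measure.-integrable `[a, b] (EFin \o F).
  apply: measurable_bounded_integrable => //.
  - by rewrite /= lebesgue_measure_itv/=; case: ifPn => // _; rewrite ltry.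
  - exact: measurable_funTS.
  - exists 1; split => // M M1 t _ /=.
    by rewrite ger0_norm// (le_trans (F1 t))// ltW.
have icst (a b r : R) :
    lebesgue_measure.-integrable `[a, b] (EFin \o (fun=> r)).
  apply: measurable_bounded_integrable => //.
  - by rewrite /= lebesgue_measure_itv/=; case: ifPn => // _; rewrite ltry.
  - exists `|r|; split => // M M1 t _ /=; exact: ltW.
have Icst (a b r : R) : a <= b ->
    \int[lebesgue_measure]_(t in `[a, b]) r = r * (b - a).
  move=> ab; rewrite Rintegral_cst//= lebesgue_measure_itv/= lte_fin.
  case: ltP => [//|ba]; suff -> : a = b by rewrite subrr.
  by apply/le_anti; rewrite ab ba.
have low (a b r : R) : a <= b -> (forall t, a <= t -> r <= F t) ->
    r * (b - a) <= \int[lebesgue_measure]_(t in `[a, b]) F t.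
  move=> ab rF; rewrite -(Icst a b r)//; apply: le_Rintegral => //.
  by move=> t /=; rewrite in_itv/= => /andP[at_ _]; exact: rF.
have upp (a b r : R) : a <= b -> (forall t, t <= b -> F t <= r) ->
    \int[lebesgue_measure]_(t in `[a, b]) F t <= r * (b - a).
  move=> ab rF; rewrite -(Icst a b r)//; apply: le_Rintegral => //.
  by move=> t /=; rewrite in_itv/= => /andP[_ tb]; exact: rF.
have split_ (a b c : R) : a <= c -> c <= b ->
    \int[lebesgue_measure]_(t in `[a, b]) F t =
    \int[lebesgue_measure]_(t in `[a, c]) F t +
    \int[lebesgue_measure]_(t in `[c, b]) F t.
  move=> ac cb; have := @Rintegral_itvB R F (BLeft a) (BRight b) c (iF a b).
  rewrite !bnd_simp => /(_ ac cb) /eqP.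
  rewrite subr_eq addrC => /eqP ->; congr (_ + _).
  rewrite Rintegral_itv_obnd_cbnd//.
  apply: integrableS (iF c b) => //.
  by apply: subset_itvr; rewrite bnd_simp.
have cF : F t @[t --> +oo] --> (1 : R).
  by rewrite FX; have /fine_cvgP[] := cvg_cdfy1 X.
have cF' : F t @[t --> -oo] --> (0 : R).
  by rewrite FX; have /fine_cvgP[] := cvg_cdfNy0 X.
have [c c0 uc] : exists2 c, 0 <= c & u <= F c.
  near (pinfty_nbhs R) => c; exists c; near: c; first exact: nbhs_pinfty_ge.
  exact: (cvgr_ge 1 cF).
have [b b0 bu] : exists2 b, b <= 0 & F b <= u.
  near (ninfty_nbhs R) => b; exists b; near: b; first exact: nbhs_ninfty_le.
  exact: (cvgr_le 0 cF').
have ar1 (a c1 x1 b1 A B : R) : b1 <= 0 -> a <= c1 -> x1 - a <= B -> 0 <= A ->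
    x1 - (A + B) <= c1 - b1 by clear; lra.
have ar2 (a x1 b1 A B : R) : a <= 0 -> A <= a - x1 -> B <= - b1 ->
    x1 + (A + B) <= - b1 by clear; lra.
have lowK (x : R) : x * u - integrated_cdf X x <= c - b.
  rewrite /integrated_cdf /oriented_integral -FX; case: ifPn => [x0|].
    have [cx|xc] := leP c x.
      rewrite (split_ 0 x c)//; apply: (ar1 (c * u)) => //.
      - by rewrite ler_piMr// ltW.
      - by rewrite -mulrBl mulrC low// => t ct; exact: le_trans uc (Fnd _ _ ct).
      - by rewrite (le_trans _ (low 0 c 0 c0 (fun t _ => F0 t)))// mul0r.
    rewrite -[\int[_]_(_ in _) _]addr0; apply: (ar1 (x * u)) => //.
    - by rewrite (le_trans _ (ltW xc))// ler_piMr// ltW.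
    - by rewrite subrr.
    - by rewrite (le_trans _ (low 0 x 0 x0 (fun t _ => F0 t)))// mul0r.
  rewrite -ltNge opprK => x0; apply: (@le_trans _ _ (- b)); last by rewrite lerDr.
  have [bx|xb] := leP b x.
    rewrite -[X in _ + X]add0r; apply: (ar2 (x * u)).
    - by rewrite pmulr_lle0// ltW.
    - by rewrite subrr.
    - rewrite (le_trans (upp x 0 1 (ltW x0) (fun t _ => F1 t)))//.
      by rewrite mul1r sub0r lerN2.
  rewrite (split_ x 0 b) ?(ltW xb)//; apply: (ar2 (b * u)).
  - by rewrite pmulr_lle0.
  - by rewrite -mulrBl mulrC upp ?ltW// => t tb; exact: le_trans (Fnd _ _ tb) bu.
  - by rewrite (le_trans (upp b 0 1 b0 (fun t _ => F1 t)))// mul1r sub0r.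
rewrite fin_numE; apply/andP; split.
  rewrite -ltNye (lt_le_trans (ltNyr (0 * u - integrated_cdf X 0)))//.
  by apply: ereal_sup_ubound; exists 0.
rewrite -ltey (le_lt_trans _ (ltry (c - b)))//.
by apply: ge_ereal_sup => _ [x _ <-]; rewrite lee_fin lowK.
Unshelve. all: by end_near. Qed.

(* Main.v *)
(* The integrated quantile function K_X is a nonnegative finite convex function
   on (0, 1) whose subgradients at u are the u-quantiles of X: F_X(c) <= u
   implies c (v - u) <= K_X(v) - K_X(u) for v > u, and symmetrically for v < u.
   Tightness means that the u-quantiles of the family are bounded for each u, so
   it is implied by a uniform bound on one increment of K on each side of every
   u; both (ii) and (iv) give such bounds. Conversely, if F_X(b) <= u <= F_X(c)
   with b <= 0 <= c then K_X(u) <= c - b, whence (iii). Finally, convex functions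
   that are pointwise bounded on (0, 1), uniformly over the family, are uniformly
   Lipschitz on each [a, b] included in (0, 1). *)
Require Import Defs.
From mathcomp Require Import all_boot all_order all_algebra.
From mathcomp Require Import all_classical all_reals all_analysis.
From mathcomp Require Import lra measurable_realfun.
Set Implicit Arguments.
Unset Strict Implicit.
Unset Printing Implicit Defensive.
Import Order.TTheory GRing.Theory Num.Theory.
Import numFieldNormedType.Exports.
Local Open Scope classical_set_scope.
Local Open Scope ring_scope.

Section integrated_functions_theory.
Context d (T : measurableType d) (R : realType) (P : probability T R).
Variable X : {RV P >-> R}.

Let F (x : R) : R := fine (cdf X x).
Let J (x : R) : R := integrated_cdf X x.
Let K (u : R) : R := fine (integrated_quantile X u).

(** * Distribution function and its integral *)

Lemma fin_num_cdf x : cdf X x \is a fin_num.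
Proof. exact: fin_num_measure. Qed.

Lemma fine_cdf_ge0 x : 0 <= F x.
Proof. by rewrite fine_ge0// cdf_ge0. Qed.

Lemma fine_cdf_le1 x : F x <= 1.
Proof. by rewrite -lee_fin fineK ?fin_num_cdf// cdf_le1. Qed.

Lemma fine_cdf_nondecreasing x y : x <= y -> F x <= F y.
Proof. by move=> xy; rewrite fine_le ?fin_num_cdf//; exact: cdf_nondecreasing. Qed.

Lemma integrable_fine_cdf (a b : R) :
  lebesgue_measure.-integrable `[a, b] (EFin \o F).
Proof.
apply: measurable_bounded_integrable => //.
- by rewrite /= lebesgue_measure_itv/=; case: ifPn => // _; rewrite ltry.
- apply: measurable_funTS; apply/measurable_EFinP.
  rewrite (_ : EFin \o F = cdf X); first exact: cdf_measurable.
  by apply/funext => x /=; rewrite fineK// fin_num_cdf.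
- exists 1; split => // M M1 t _ /=.
  by rewrite ger0_norm ?fine_cdf_ge0// (le_trans (fine_cdf_le1 t))// ltW.
Qed.

Lemma Rintegral_segment_cst (a b r : R) : a <= b ->
  \int[lebesgue_measure]_(t in `[a, b]) r = r * (b - a).
Proof.
move=> ab; rewrite Rintegral_cst//= lebesgue_measure_itv/= lte_fin.
case: ltP => [//|ba]; suff -> : a = b by rewrite subrr.
by apply/le_anti; rewrite ab ba.
Qed.

Lemma Rintegral_fine_cdf_split (a b c : R) : a <= b -> b <= c ->
  \int[lebesgue_measure]_(t in `[a, c]) F t =
  \int[lebesgue_measure]_(t in `[a, b]) F t +
  \int[lebesgue_measure]_(t in `[b, c]) F t.
Proof.
move=> ab bc; apply/eqP; rewrite addrC -subr_eq; apply/eqP.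
rewrite Rintegral_itvB ?bnd_simp//; last exact: integrable_fine_cdf.
rewrite Rintegral_itv_obnd_cbnd//; apply: integrableS (integrable_fine_cdf b c) => //.
by apply: subset_itvr; rewrite bnd_simp.
Qed.

Lemma integrated_cdf0 : J 0 = 0.
Proof. by rewrite /J /integrated_cdf /oriented_integral lexx set_itv1 Rintegral_set1. Qed.

Lemma integrated_cdfB x y : x <= y ->
  J y - J x = \int[lebesgue_measure]_(t in `[x, y]) F t.
Proof.
move=> xy; rewrite /J /integrated_cdf /oriented_integral -/F.
case: (leP 0 y) => [y0|y0]; case: (leP 0 x) => x0.
- by rewrite (Rintegral_fine_cdf_split x0 xy) addrAC subrr add0r.
- by rewrite (Rintegral_fine_cdf_split (ltW x0) y0) opprK addrC.
- by have := lt_le_trans y0 (le_trans x0 xy); rewrite ltxx.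
- by rewrite (Rintegral_fine_cdf_split xy (ltW y0)) opprK addrC addrK.
Qed.

(** Monotonicity of [F] bounds the integrand on [[x, y]] by its values at the ends. Together with
    [integrated_cdf0], this is all that later arguments use about [J]. *)
Lemma integrated_cdf_slope x y : x <= y ->
  F x * (y - x) <= J y - J x <= F y * (y - x).
Proof.
move=> xy; rewrite integrated_cdfB// -!(Rintegral_segment_cst _ xy).
have icst r : lebesgue_measure.-integrable `[x, y] (EFin \o (fun=> r : R)).
  apply: measurable_bounded_integrable => //.
  - by rewrite /= lebesgue_measure_itv/=; case: ifPn => // _; rewrite ltry.
  - by exists `|r|; split => // M M1 t _ /=; exact: ltW.
by apply/andP; split; apply: le_Rintegral => //;
  do ?[exact: icst|exact: integrable_fine_cdf];
  move=> t /=; rewrite in_itv/= => /andP[xt ty]; exact: fine_cdf_nondecreasing.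
Qed.

(** * Convexity, subgradients and bounds of the integrated quantile function *)

Lemma le_integrated_quantile u x : 0 < u < 1 -> x * u - J x <= K u.
Proof.
move=> u01; rewrite -lee_fin fineK ?integrated_quantile_fin_num//.
by apply: ereal_sup_ubound; exists x.
Qed.

Lemma integrated_quantile_le u M : 0 < u < 1 ->
  (forall x, x * u - J x <= M) -> K u <= M.
Proof.
move=> u01 uM; rewrite -lee_fin fineK ?integrated_quantile_fin_num//.
by apply: ge_ereal_sup => _ [x _ <-]; rewrite lee_fin uM.
Qed.

Lemma integrated_quantile_ge0 u : 0 < u < 1 -> 0 <= K u.
Proof.
move=> /(le_integrated_quantile 0); rewrite integrated_cdf0; lra.
Qed.

(** For fixed [x] the term [x * v - J x] is affine in [v], and a supremum of affine functions is
    convex. *)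
Lemma integrated_quantile_convex u v w : 0 < u -> u < v -> v < w -> w < 1 ->
  (w - u) * K v <= (w - v) * K u + (v - u) * K w.
Proof.
move=> u0 uv vw w1; rewrite mulrC -ler_pdivlMr; last lra.
apply: integrated_quantile_le => [|x]; first lra.
rewrite ler_pdivlMr; last lra.
have /(ler_wpM2l _) Ku : x * u - J x <= K u by apply: le_integrated_quantile; lra.
have /(ler_wpM2l _) Kw : x * w - J x <= K w by apply: le_integrated_quantile; lra.
have := lerD (Ku (w - v) _) (Kw (v - u) _); rewrite !subr_ge0 (ltW uv) (ltW vw).
by move=> /(_ isT isT); lra.
Qed.

(** Each [x * u - J x] is compared with one term of the supremum at [v]: the term at [x] if
    [c <= x], and the term at [c] if [x < c], where [J c - J x <= F c * (c - x) <= u * (c - x)]. *)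
Lemma integrated_quantile_subgradientr c u v : F c <= u -> 0 < u -> u < v ->
  v < 1 -> c * (v - u) <= K v - K u.
Proof.
move=> cu u0 uv v1; suff : K u <= K v - c * (v - u) by lra.
apply: integrated_quantile_le => [|x]; first lra.
have [cx|/ltW xc] := leP c x.
  by have := le_integrated_quantile x (_ : 0 < v < 1); nra.
have := le_integrated_quantile c (_ : 0 < v < 1).
by have /andP[_] := integrated_cdf_slope xc; nra.
Qed.

Lemma integrated_quantile_subgradientl c u v : u <= F c -> 0 < v -> v < u ->
  u < 1 -> c * (v - u) <= K v - K u.
Proof.
move=> cu v0 vu u1; suff : K u <= K v - c * (v - u) by lra.
apply: integrated_quantile_le => [|x]; first lra.
have [xc|/ltW cx] := leP x c.
  by have := le_integrated_quantile x (_ : 0 < v < 1); nra.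
have := le_integrated_quantile c (_ : 0 < v < 1).
by have /andP[+ _] := integrated_cdf_slope cx; nra.
Qed.

Lemma integrated_quantile_le_quantiles b c u : 0 < u < 1 -> b <= 0 -> 0 <= c ->
  F b <= u -> u <= F c -> K u <= c - b.
Proof.
move=> /[dup] u01 /andP[u0 u1] b0 c0 bu cu.
apply: integrated_quantile_le => // x.
have J0 y : 0 <= y -> 0 <= J y.
  move=> y0; have /andP[+ _] := integrated_cdf_slope y0.
  by have := fine_cdf_ge0 0; rewrite integrated_cdf0; nra.
have JN y : y <= 0 -> y <= J y.
  move=> y0; have /andP[_] := integrated_cdf_slope y0.
  by have := fine_cdf_le1 0; rewrite integrated_cdf0; nra.
(* Left of [b] the term [x * u - J x] is at most its value at [b], and right of [c] at most its
   value at [c]. In between, [J x >= x] for [x <= 0] and [J x >= 0] for [x >= 0] suffice. *)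
have [xb|/ltW bx] := leP x b.
  have /andP[_] := integrated_cdf_slope xb; have := JN b b0; nra.
have [x0|/ltW x0] := leP x 0; first by have := JN x x0; nra.
have [xc|/ltW cx] := leP x c; first by have := J0 x x0; nra.
by have /andP[+ _] := integrated_cdf_slope cx; have := J0 c c0; nra.
Qed.

End integrated_functions_theory.

(** * Equicontinuity on a subset in epsilon form *)

Lemma equicontinuous_onP (R : realType) (I : Type) (D : set R)
    (f : I -> R -> R) :
  equicontinuous_on D f <->
  forall (x e : R), D x -> 0 < e -> \forall y \near x, D y ->
    forall i, `|f i x - f i y| < e.
Proof.
split=> [fD x e Dx e0|fD x E].
  have := fD x _ (entourage_ball R (PosNum e0)).
  rewrite /prop_near1; case: (nbhs_subspaceP D x) => // _.
  by apply: (@filterS _ (nbhs x)) => y fxy Dy i; exact: fxy Dy i Logic.I.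
rewrite -entourage_ballE => -[e /= e0 eE].
rewrite /prop_near1; case: (nbhs_subspaceP D x) => Dx; last first.
  (* Points outside [D] are isolated in the subspace topology, so only [y = x] remains. *)
  by move=> y -> i _; apply: eE; exact: ballxx.
have := fD x e Dx e0.
by apply: (@filterS _ (@nbhs R R x)) => y fxy Dy i _; apply: eE; exact: fxy Dy i.
Qed.

(** * Families: tightness, uniform bounds and equicontinuity *)

Section families.
Context (R : realType) (I : Type) (d : I -> measure_display)
  (T : forall i : I, measurableType (d i))
  (P : forall i : I, probability (T i) R)
  (X : forall i : I, {RV (P i) >-> R}).

Let F i (x : R) : R := fine (cdf (X i) x).
Let K i (u : R) : R := fine (integrated_quantile (X i) u).
Let mu i : probability _ R := distribution (P i) (X i).

Lemma tight_quantiles e : tight mu -> 0 < e ->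
  exists b c, [/\ b <= 0, 0 <= c, forall i, F i b <= e & forall i, 1 - e <= F i c].
Proof.
move=> /[apply] -[A cA Ae].
have [M [Mreal AM]] := compact_bounded cA.
(* [compact_bounded] gives [A] a bound by every number strictly above [M], hence the [+ 1]; the
   maximum makes [m] nonnegative. *)
pose m := Num.max 0 M + 1.
have m0 : 0 <= m by rewrite addr_ge0// le_max lexx.
have {}AM x : A x -> `|x| <= m.
  by apply: AM; rewrite (le_lt_trans (_ : M <= Num.max 0 M)) ?ltrDl// le_max lexx orbT.
have mA : measurable A by apply: closed_measurable; exact: compact_closed.
(* The left point is moved past [- m] because the half-line up to [- m] is closed and could still
   meet [A]. *)
exists (- (m + 1)), m; split=> [|//|i|i]; first lra.
  rewrite -lee_fin fineK ?fin_num_cdf//; apply: le_trans (Ae i).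
  apply: le_measure; rewrite ?inE//; first exact: measurableC.
  by move=> x /=; rewrite in_itv/= => xm /AM; rewrite ler_norml; lra.
rewrite -lee_fin fineK ?fin_num_cdf//.
apply: (@le_trans _ _ (mu i A)).
  rewrite -[A]setCK probability_setC; last exact: measurableC.
  by rewrite EFinB leeB.
apply: le_measure; rewrite ?inE// => x /AM /=.
by rewrite in_itv/= ler_norml => /andP[].
Qed.

Lemma quantiles_tight :
  (forall u : R, 0 < u < 1 -> exists b, forall i, F i b <= u) ->
  (forall u : R, 0 < u < 1 -> exists c, forall i, u <= F i c) -> tight mu.
Proof.
(* Each tail outside [[b, c]] will have mass at most [u <= e / 2]; the cap [1 / 2] keeps [u] and
   [1 - u] inside (0, 1). *)
move=> Fb Fc e e0; pose u := Num.min (e / 2) (1 / 2).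
have ue : u <= e / 2 by rewrite ge_min lexx.
have u1 : u <= 1 / 2 by rewrite ge_min lexx orbT.
have u0 : 0 < u by rewrite lt_min; lra.
have [|b bu] := Fb u; first lra.
have [|c cu] := Fc (1 - u); first lra.
exists `[b, c]%classic; first exact: segment_compact.
move=> i; apply: (@le_trans _ _ (mu i (`]-oo, b] `|` ~` `]-oo, c]))).
  apply: le_measure; rewrite ?inE//; do ?[exact: measurableC].
    by apply: measurableU => //; exact: measurableC.
  move=> x /=; rewrite !in_itv/=; have [bx|/ltW xb _] := leP b x; last by left.
  by move=> xc; right.
apply: (le_trans (measureU2 _ _ _)) => //; first exact: measurableC.
apply: (@le_trans _ _ (u%:E + (1 - (1 - u)%:E))%E); last first.
  by rewrite -EFinB -EFinD lee_fin; lra.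
apply: leeD.
  by have := bu i; rewrite -lee_fin fineK ?fin_num_cdf.
apply: (@le_trans _ _ (1 - cdf (X i) c)%E).
  by rewrite -(probability_setC (mu i)).
by rewrite leeB// -[leRHS]fineK ?fin_num_cdf// lee_fin cu.
Qed.

Lemma tight_of_increments :
  (forall u : R, 0 < u < 1 -> exists2 v, u < v < 1 &
     exists M, forall i, K i v - K i u <= M) ->
  (forall u : R, 0 < u < 1 -> exists2 v, 0 < v < u &
     exists M, forall i, K i v - K i u <= M) ->
  tight mu.
Proof.
move=> Kr Kl; apply: quantiles_tight => u u01.
  have [v uv [M KM]] := Kl u u01.
  (* If this point failed, it would be a subgradient at [u], forcing an increment of at least
     [M + 1] against the bound [M]. *)
  exists ((M + 1) / (v - u)) => i; rewrite leNgt; apply/negP => /ltW uF.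
  have := integrated_quantile_subgradientl uF (v := v).
  have := KM i; rewrite divfK; last by rewrite subr_eq0 lt_eqF; lra.
  rewrite /K; lra.
have [v uv [M KM]] := Kr u u01.
exists ((M + 1) / (v - u)) => i; rewrite leNgt; apply/negP => /ltW uF.
have := integrated_quantile_subgradientr uF (v := v).
have := KM i; rewrite divfK; last by rewrite subr_eq0 gt_eqF; lra.
rewrite /K; lra.
Qed.

Lemma tight_integrated_quantile_bounded u : tight mu -> 0 < u < 1 ->
  exists M, forall i, K i u <= M.
Proof.
move=> tmu /andP[u0 u1].
(* This level makes both [F i b <= u] and [u <= F i c] hold. *)
have [|b [c [b0 c0 bu cu]]] := tight_quantiles (e := Num.min u (1 - u)) tmu.
  by rewrite lt_min u0 subr_gt0.
have eu : Num.min u (1 - u) <= u by rewrite ge_min lexx.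
have eu1 : Num.min u (1 - u) <= 1 - u by rewrite ge_min lexx orbT.
exists (c - b) => i; apply: integrated_quantile_le_quantiles => //.
- by rewrite u0.
- exact: le_trans (bu i) eu.
- by apply: le_trans (cu i); lra.
Qed.

(** A Lipschitz estimate with constant [M] over the minimum: convexity compares the chord over [u],
    [v] with chords reaching [a / 2] and [(b + 1) / 2], whose lengths are at least that minimum and
    whose rise is at most [M] since [K] is nonnegative. *)
Lemma integrated_quantile_increment_le i a b M u v : 0 < a -> a < b -> b < 1 ->
  K i (a / 2) <= M -> K i ((b + 1) / 2) <= M ->
  a <= u <= b -> a <= v <= b ->
  Num.min (a / 2) ((1 - b) / 2) * `|K i u - K i v| <= M * `|u - v|.
Proof.
move=> a0 ab b1 Ka Kb.
wlog uv : u v / u < v.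
  move=> H aub avb; have [uv|vu|->] := ltgtP u v; first exact: H.
    by rewrite distrC (distrC u); exact: H.
  by rewrite !subrr normr0 !mulr0.
move=> /andP[au ub] /andP[av vb].
have Ku : 0 <= K i u by apply: integrated_quantile_ge0; lra.
have Kv : 0 <= K i v by apply: integrated_quantile_ge0; lra.
(* [Hl] limits a decrease of [K i] from [u] to [v], and [Hr] an increase. *)
have Hl : (u - a / 2) * (K i u - K i v) <= (v - u) * (K i (a / 2) - K i u).
  have := integrated_quantile_convex (X i) (u := a / 2) (v := u) (w := v).
  by rewrite -/(K i _) -/(K i _) -/(K i _); lra.
have Hr : ((b + 1) / 2 - v) * (K i v - K i u) <=
    (v - u) * (K i ((b + 1) / 2) - K i v).
  have := integrated_quantile_convex (X i) (u := u) (v := v) (w := (b + 1) / 2).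
  by rewrite -/(K i _) -/(K i _) -/(K i _); lra.
set m := Num.min _ _.
have ma : m <= a / 2 by rewrite ge_min lexx.
have mb : m <= (1 - b) / 2 by rewrite ge_min lexx orbT.
have m0 : 0 < m by rewrite lt_min; lra.
rewrite (distrC u) (gtr0_norm (_ : 0 < v - u)) ?subr_gt0//.
have [Kuv|/ltW Kvu] := leP (K i u) (K i v).
  rewrite ler0_norm ?subr_le0// opprB.
  apply: (@le_trans _ _ (((b + 1) / 2 - v) * (K i v - K i u))).
    by rewrite ler_wpM2r ?subr_ge0//; lra.
  rewrite (le_trans Hr)// mulrC; apply: ler_wpM2r; first by rewrite subr_ge0 ltW.
  by move: Ka Kb; lra.
rewrite ger0_norm ?subr_ge0//.
apply: (@le_trans _ _ ((u - a / 2) * (K i u - K i v))).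
  by rewrite ler_wpM2r ?subr_ge0//; lra.
rewrite (le_trans Hl)// mulrC; apply: ler_wpM2r; first by rewrite subr_ge0 ltW.
  by move: Ka Kb; lra.
Qed.

Lemma bounded_equicontinuous_on a b :
  (forall u : R, 0 < u < 1 -> exists M, forall i, K i u <= M) ->
  `[a, b] `<=` `]0, 1[ -> equicontinuous_on `[a, b] K.
Proof.
move=> KM ab01; apply/equicontinuous_onP => u e; rewrite /= in_itv/= => aub e0.
(* Here the segment has at most one point. *)
have [ba|ab] := leP b a.
  near=> v; rewrite /= in_itv/= => avb i.
  by rewrite (_ : v = u) ?subrr ?normr0//; lra.
have := ab01 a; have := ab01 b; rewrite /= !in_itv/= !lexx (ltW ab).
move=> /(_ isT) /andP[_ b1] /(_ isT) /andP[a0 _].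
have [|M1 KM1] := KM (a / 2); first lra.
have [|M2 KM2] := KM ((b + 1) / 2); first lra.
pose M := `|M1| + `|M2| + 1.
have M0 : 0 < M by rewrite ltr_wpDl// addr_ge0.
pose m := Num.min (a / 2) ((1 - b) / 2).
have m0 : 0 < m by rewrite lt_min; lra.
(* This is the radius matching the Lipschitz constant [M / m]. *)
have d0 : 0 < m * e / M by rewrite divr_gt0// mulr_gt0.
near=> v; rewrite /= in_itv/= => avb i; rewrite -(ltr_pM2l m0).
apply: le_lt_trans (integrated_quantile_increment_le (M := M) _ ab _ _ _ aub avb) _ => //.
- by rewrite (le_trans (KM1 i))// /M; have := ler_norm M1; have := normr_ge0 M2; lra.
- by rewrite (le_trans (KM2 i))// /M; have := ler_norm M2; have := normr_ge0 M1; lra.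
rewrite mulrC -ltr_pdivlMr//; near: v.
Unshelve. all: by end_near. Qed.

(** The segment contains [u] in its interior and lies in (0, 1), so equicontinuity at [u] with
    tolerance 1 gives one two-sided neighbourhood valid for all [i]. *)
Lemma equicontinuous_on_increment u : 0 < u < 1 ->
  equicontinuous_on `[u / 2, (u + 1) / 2] K ->
  exists2 h, 0 < h & forall v, u - h < v < u + h ->
    0 < v < 1 /\ forall i, K i v - K i u <= 1.
Proof.
move=> u01 /equicontinuous_onP /(_ u 1 _ ltr01).
rewrite /= in_itv/= => /(_ ltac:(lra)) /nbhs_ballP[r /= r0 Kr].
pose h := Num.min r (Num.min (u / 2) ((1 - u) / 2)).
have hr : h <= r by rewrite ge_min lexx.
have hu : h <= u / 2 by rewrite !ge_min lexx orbT.
have hu1 : h <= (1 - u) / 2 by rewrite !ge_min lexx !orbT.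
exists h => [|v vh]; first by rewrite !lt_min r0; lra.
split; first lra.
move=> i; rewrite (le_trans (ler_norm _))// distrC ltW// Kr//.
  by rewrite /ball/= ltr_norml; lra.
by rewrite /= in_itv/=; lra.
Qed.

End families.

Theorem theorem6 (R : realType) (I : Type) (d : I -> measure_display)
    (T : forall i : I, measurableType (d i))
    (P : forall i : I, probability (T i) R)
    (X : forall i : I, {RV (P i) >-> R}) :
  [<-> tight (fun i => distribution (P i) (X i) : probability _ R);
       forall u v : R, 0 < u < 1 -> 0 < v < 1 ->
         (ereal_sup (range (fun i =>
            `|integrated_quantile (X i) u - integrated_quantile (X i) v|))
          < +oo)%E;
       forall u : R, 0 < u < 1 ->
         exists M : R, forall i, (`|integrated_quantile (X i) u| <= M%:E)%E;
       forall a b : R, `[a, b] `<=` `]0, 1[ ->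
         equicontinuous_on `[a, b]
           (fun i u => fine (integrated_quantile (X i) u))].
Proof.
pose K i u := fine (integrated_quantile (X i) u).
have KE i (u : R) : 0 < u < 1 -> integrated_quantile (X i) u = (K i u)%:E.
  by move=> u01; rewrite fineK// integrated_quantile_fin_num.
have K0 i (u : R) : 0 < u < 1 -> 0 <= K i u by exact: integrated_quantile_ge0.
tfae.
- move=> tX u v u01 v01.
  have [M KM] := tight_integrated_quantile_bounded tX u01.
  have [N KN] := tight_integrated_quantile_bounded tX v01.
  apply: le_lt_trans (ltry (M + N)); apply: ge_ereal_sup => _ [i _ <-].
  rewrite !KE// -EFinB lee_fin (le_trans (ler_normB _ _))//.
  by rewrite !ger0_norm ?K0 ?lerD ?KM ?KN.
- move=> Kuv u u01.
  (* Increments are turned into a bound on [K] itself by way of tightness. *)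
  suff : tight (fun i => distribution (P i) (X i) : probability _ R).
    move=> /tight_integrated_quantile_bounded/(_ u01) [M KM].
    by exists M => i; rewrite KE// lee_fin ger0_norm ?K0 ?KM.
  have KM (v w : R) : 0 < v < 1 -> 0 < w < 1 -> exists M, forall i, K i w - K i v <= M.
    move=> v01 w01; move: (Kuv w v w01 v01).
    set s := ereal_sup _ => soo.
    have Ks i : ((K i w - K i v)%:E <= s)%E.
      apply: (@le_trans _ _ `|(K i w - K i v)%:E|%E); first exact: lee_abs.
      by apply: ereal_sup_ubound; exists i; rewrite // !KE// EFinB.
    (* For an empty family [s] is -oo; its finiteness is derived from the given index [i]. *)
    exists (fine s) => i; rewrite -lee_fin fineK//.
    by rewrite fin_numElt soo (lt_le_trans (ltNyr _) (Ks i)).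
  apply: tight_of_increments => v v01.
    by exists ((v + 1) / 2); [lra|apply: KM => //; lra].
  by exists (v / 2); [lra|apply: KM => //; lra].
- move=> KM a b ab; apply: bounded_equicontinuous_on => // u u01.
  have [M KuM] := KM u u01; exists M => i.
  by rewrite -lee_fin -[X in (X <= _)%E]KE// (le_trans (lee_abs _)).
- move=> Keq; apply: tight_of_increments => u u01.
    have [|h h0 Kh] := equicontinuous_on_increment u01 (X := X).
      by apply: Keq => x /=; rewrite !in_itv/=; lra.
    have [|v1 Kv] := Kh (u + h / 2); first lra.
    by exists (u + h / 2); [lra|exists 1].
  have [|h h0 Kh] := equicontinuous_on_increment u01 (X := X).
    by apply: Keq => x /=; rewrite !in_itv/=; lra.
  have [|v1 Kv] := Kh (u - h / 2); first lra.
  by exists (u - h / 2); [lra|exists 1].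
Qed.
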